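(* Let $n \geq d \geq 1$ be integers. For every $f\colon \{-1,1\}^n \to \{-1,1\}$ there exists $I \subseteq [n]$ with $|I| = d$ such that $$\mathrm{JInf}_I(f) \;\geq\; \mathrm{Inf}_I(f) \;\geq\; \frac{1}{10}\, \mathbf{W}^{\geq d}(f) \left(\frac{\ln n}{n}\right)^d .$$
   Context: $[n]=\{1,\dots,n\}$; $\mu_n$ is the uniform probability measure on $\{-1,1\}^n$, and $\mathbf{x}$ denotes a random point with law $\mu_n$. For $J \subseteq [n]$ let $\chi_J(x) = \prod_{j\in J} x_j$ (with $\chi_\varnothing = 1$); every $f\colon\{-1,1\}^n\to\mathbb{R}$ has a unique expansion $f=\sum_{J\subseteq [n]} \hat f(J)\chi_J$, with $\hat f(J) = \mathbb{E}[f(\mathbf{x})\chi_J(\mathbf{x})]$. Fourier weight: $\mathbf{W}^{\geq d}(f) = \sum_{J\subseteq[n],\,|J|\geq d} \hat f(J)^2$. T-influence: for $I\subseteq[n]$, $\mathrm{Inf}_I(f) = \sum_{J \supseteq I} \hat f(J)^2$ (sum over $J \subseteq [n]$). Joint influence: for $y\in\{-1,1\}^n$ let $y^{\oplus i}$ be $y$ with its $i$-th coordinate negated. For non-empty $I\subseteq [n]$, an index $i\in I$ is called $I$-pivotal for $f$ on input $x$ if there is $y\in\{-1,1\}^n$ agreeing with $x$ on all coordinates in $[n]\setminus I$ such that $f(y)\neq f(y^{\oplus i})$. Then $\mathrm{JInf}_I(f) = \mathbb{P}_{\mathbf{x}\sim\mu_n}(\text{every } i\in I \text{ is } I\text{-pivotal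 for } f \text{ on input } \mathbf{x})$. *)

(* Defs.v *)
From HB Require Import structures.
From mathcomp Require Import all_boot all_order all_algebra.
From mathcomp Require Import reals exp.

Set Implicit Arguments.
Unset Strict Implicit.
Unset Printing Implicit Defensive.

Import Order.TTheory GRing.Theory Num.Theory.
Local Open Scope ring_scope.

(* The discrete cube {-1,1}^n, with each sign s encoded by the boolean b such
   that s = (-1) ^+ b (so false is +1 and true is -1); see [coord]. *)
Definition cube (n : nat) := {ffun 'I_n -> bool}.

Definition coord (R : realType) (n : nat) (x : cube n) (j : 'I_n) : R :=
  (-1) ^+ x j.

Definition expect (R : realType) (n : nat) (g : cube n -> R) : R :=
  (\sum_(x : cube n) g x) / #|{: cube n}|%:R.

Definition prob (R : realType) (n : nat) (P : pred (cube n)) : R :=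
  #|P|%:R / #|{: cube n}|%:R.

Definition chi (R : realType) (n : nat) (J : {set 'I_n}) (x : cube n) : R :=
  \prod_(j in J) coord R x j.

Definition fourier (R : realType) (n : nat) (f : cube n -> R)
    (J : {set 'I_n}) : R :=
  expect (fun x => f x * chi R J x).

Definition weight_ge (R : realType) (n d : nat) (f : cube n -> R) : R :=
  \sum_(J : {set 'I_n} | (d <= #|J|)%N) fourier f J ^+ 2.

Definition Tinf (R : realType) (n : nat) (I : {set 'I_n}) (f : cube n -> R)
    : R :=
  \sum_(J : {set 'I_n} | I \subset J) fourier f J ^+ 2.

Definition flip (n : nat) (y : cube n) (i : 'I_n) : cube n :=
  [ffun j => if j == i then ~~ y j else y j].

Definition pivotal (R : realType) (n : nat) (I : {set 'I_n}) (f : cube n -> R)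
    (x : cube n) (i : 'I_n) : bool :=
  [exists y : cube n,
    [forall j in ~: I, y j == x j] && (f y != f (flip y i))].

(* Meaningful for non-empty I; for I = set0 the value is 1. *)
Definition JInf (R : realType) (n : nat) (I : {set 'I_n}) (f : cube n -> R)
    : R :=
  prob R (fun x : cube n => [forall i in I, pivotal I f x i]).

(* Main.v *)
Require Import Defs.
From HB Require Import structures.
From mathcomp Require Import all_boot all_order all_algebra.
From mathcomp Require Import reals sequences exp.
From mathcomp Require Import ring lra.

Set Implicit Arguments.
Unset Strict Implicit.
Unset Printing Implicit Defensive.

(* From here on, [coord] is the sign of a coordinate of the cube, not a
   coordinate in a basis of a vector space. *)
Import Defs.
Import Order.TTheory GRing.Theory Num.Theory.
Local Open Scope ring_scope.

(** Let T_I f = \sum_(J \supset I) f^(J) chi_J, so that Inf_I(f) = E[(T_I f)^2].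
    Up to the sign chi_I, T_I f is an iterated discrete derivative of f:
    T_(i |: I) f (x) is half the difference of T_I f at x and at the flip of x
    at i (Tpart_setU1).  For f with values in {-1, 1} this gives |T_I f| <= 1;
    it shows that T_I f vanishes at x unless every i in I is I-pivotal on
    input x, whence Inf_I <= JInf_I (Tinf_le_JInf); and it shows that
    2^(|I|-1) T_I f is integer valued (Tpart_gap).

    For the lower bound, suppose that Inf_I(f) < t := W/10 (L/n)^d for all I of
    size d, where W = W^{>=d}(f) and L = ln n.  Write w_J = f^(J)^2 and
    m_J = |J| - d for |J| >= d.

    - Hypercontractivity.  Bonami's (2,4)-inequality (bonami), applied to T_I f
      with its coefficients damped by 3^-|J \ I|, and the fact that T_I f is
      either 0 or at least 2^(1-d) in absolute value, give
      \sum_(J \supset I) 3^-|J \ I| f^(J)^2 <= 2^(d-1) Inf_I^(3/2)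
      (sqr_Tinf_noisy_le).

    - Summing over I.  Each J contains C(|J|, d) sets I of size d, so
      B := \sum_I Inf_I = \sum_J C(|J|, d) f^(J)^2, and
      d! B <= n^d t = W L^d / 10.  Since d! C(m+d, d) >= (m+1)^d, the power mean
      inequality bounds the w-average of m_J + 1 by mu := d L / 6, because
      1/10 <= (d/6)^d for all d >= 1.  By Jensen and 3 <= e^(6/5),
      W e^(-6/5 (mu - 1)) <= \sum_J w_J 3^-m_J, which by the first step is at
      most 2^(d-1) t^(1/2) B.

    - Numerics.  Dividing by W, using W <= 1 and squaring, this becomes
      36000 d!^2 (e^(3L/5))^d <= (4 L^3)^d, whereas e^(3L/5) >= L^3 / 8 and
      36000 d!^2 > 32^d (no_small_influence). *)

(** * Expectations on the cube *)

Section Expectation.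
Variables (R : realType) (n : nat).
Implicit Types (g h : cube n -> R) (x y : cube n) (i j : 'I_n).

Lemma card_cube_gt0 : 0 < #|{: cube n}|%:R :> R.
Proof. by rewrite ltr0n; apply/card_gt0P; exists [ffun=> false]. Qed.

Lemma eq_expect g h : g =1 h -> expect g = expect h.
Proof. by move=> gh; rewrite /expect (eq_bigr h). Qed.

Lemma expectD g h : expect (fun x => g x + h x) = expect g + expect h.
Proof. by rewrite /expect big_split mulrDl. Qed.

Lemma expectZ (c : R) g : expect (fun x => c * g x) = c * expect g.
Proof. by rewrite /expect -mulr_sumr mulrA. Qed.

Lemma expect_sum (T : finType) (P : pred T) (F : T -> cube n -> R) :
  expect (fun x => \sum_(t | P t) F t x) = \sum_(t | P t) expect (F t).
Proof. by rewrite /expect exchange_big /= mulr_suml. Qed.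

Lemma ler_expect g h : (forall x, g x <= h x) -> expect g <= expect h.
Proof.
move=> gh; rewrite /expect ler_wpM2r //; last first.
  by apply: ler_sum => x _; exact: gh.
by rewrite invr_ge0 ltW // card_cube_gt0.
Qed.

Lemma expect_cst (c : R) : expect (fun _ : cube n => c) = c.
Proof.
rewrite /expect sumr_const -[c *+ _]mulr_natr mulfK //.
by rewrite gt_eqF ?card_cube_gt0.
Qed.

Lemma expect_ge0 g : (forall x, 0 <= g x) -> 0 <= expect g.
Proof. by move=> g0; rewrite -(expect_cst 0); apply: ler_expect. Qed.

Lemma prob_expect (P : pred (cube n)) : prob R P = expect (fun x => (P x)%:R).
Proof. by rewrite /prob /expect -natr_sum -sum1_card big_mkcond. Qed.

(** The discriminant of the nonnegative polynomial t |-> E[(g - t h)^2]. *)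
Lemma expect_CauchySchwarz g h :
  expect (fun x => g x * h x) ^+ 2
  <= expect (fun x => g x ^+ 2) * expect (fun x => h x ^+ 2).
Proof.
set b := expect _; set a := expect _; set c := expect _.
have a_ge0 : 0 <= a by apply: expect_ge0 => x; exact: sqr_ge0.
have c_ge0 : 0 <= c by apply: expect_ge0 => x; exact: sqr_ge0.
have quad t : 0 <= a + (-2 * t) * b + t ^+ 2 * c.
  rewrite -!expectZ -!expectD; apply: expect_ge0 => x.
  rewrite (_ : _ + _ = (g x - t * h x) ^+ 2); last by ring.
  exact: sqr_ge0.
have [c0|c_neq0] := eqVneq c 0.
  have [-> | b_neq0] := eqVneq b 0; first by rewrite expr0n mulr_ge0.
  have := quad ((a + 1) / (2 * b)).
  rewrite c0 mulr0 addr0 (_ : -2 * _ * b = - (a + 1)); last by field.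
  by lra.
have c_gt0 : 0 < c by rewrite lt_def c_neq0.
have := mulr_ge0 c_ge0 (quad (b / c)).
rewrite (_ : c * _ = a * c - b ^+ 2); first by rewrite subr_ge0.
by field.
Qed.

Lemma flipK i : involutive ((@flip n)^~ i).
Proof.
move=> x; apply/ffunP => j; rewrite !ffunE.
by case: eqP => // _; rewrite negbK.
Qed.

Lemma flipC x i j : flip (flip x i) j = flip (flip x j) i.
Proof. by apply/ffunP => k; rewrite !ffunE; do 2!case: ifP. Qed.

Lemma expect_flip g i : expect (fun x => g (flip x i)) = expect g.
Proof. by rewrite /expect [in RHS](reindex_inj (can_inj (flipK i))). Qed.

Lemma expect_odd g i : (forall x, g (flip x i) = - g x) -> expect g = 0.
Proof.
move=> g_odd; have := expect_flip g i.
rewrite (eq_expect g_odd) -(eq_expect (fun x => mulN1r (g x))) expectZ.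
by lra.
Qed.

End Expectation.

(** * Characters and Bonami's inequality *)

Section Characters.
Variables (R : realType) (n : nat).
Implicit Types (f : cube n -> R) (b : {set 'I_n} -> R).
Implicit Types (x y : cube n) (i j : 'I_n) (I J A : {set 'I_n}).

Lemma coord_flip x i j :
  coord R (flip x i) j = (if j == i then -1 else 1) * coord R x j.
Proof.
rewrite /coord ffunE; case: eqP => _; last by rewrite mul1r.
by rewrite signrN mulN1r.
Qed.

Lemma sqr_coord x i : coord R x i ^+ 2 = 1.
Proof. by rewrite /coord sqrr_sign. Qed.

Lemma chi_setU1 i J x : i \notin J ->
  chi R (i |: J) x = coord R x i * chi R J x.
Proof. by move=> iJ; rewrite /chi big_setU1. Qed.

Lemma chi_flip_out i J x : i \notin J -> chi R J (flip x i) = chi R J x.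
Proof.
move=> iJ; apply: eq_bigr => j jJ; rewrite coord_flip.
by case: eqP jJ iJ => [-> ->//|_ _ _]; rewrite mul1r.
Qed.

Lemma chi_flip_in i J x : i \in J -> chi R J (flip x i) = - chi R J x.
Proof.
move=> iJ; rewrite -(setD1K iJ) !chi_setU1 ?setD11 //.
by rewrite chi_flip_out ?setD11 // coord_flip eqxx mulN1r mulNr.
Qed.

Lemma sqr_chi J x : chi R J x ^+ 2 = 1.
Proof. by rewrite /chi -prodrXl big1 // => j _; exact: sqr_coord. Qed.

Lemma expect_chiM J K :
  expect (fun x => chi R J x * chi R K x) = (J == K)%:R.
Proof.
have [->|] := eqVneq J K.
  rewrite -[RHS](expect_cst n); apply: eq_expect => x.
  by rewrite -expr2 sqr_chi.
rewrite eqEsubset negb_and => /orP[] /subsetPn[i iJ iK];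
  by apply: (expect_odd (i := i)) => x;
     rewrite (chi_flip_in x iJ) (chi_flip_out x iK) ?mulrN ?mulNr.
Qed.

Lemma expect_sqr_sum (P : pred {set 'I_n}) b :
  expect (fun x => (\sum_(J | P J) b J * chi R J x) ^+ 2) =
  \sum_(J | P J) b J ^+ 2.
Proof.
under eq_expect => x do rewrite expr2 mulr_suml.
rewrite expect_sum; apply: eq_bigr => J PJ.
under eq_expect => x.
  rewrite mulr_sumr.
  under eq_bigr => K _ do rewrite mulrACA.
  over.
rewrite expect_sum (bigD1 J) //= big1 ?addr0 => [|K /andP[_ KJ]].
  by rewrite expectZ expect_chiM eqxx mulr1 expr2.
by rewrite expectZ expect_chiM eq_sym (negbTE KJ) mulr0.
Qed.

Lemma sum_chiM x y :
  \sum_J chi R J x * chi R J y = (x == y)%:R * #|{: cube n}|%:R.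
Proof.
have -> : \sum_J chi R J x * chi R J y =
    \prod_i (coord R x i * coord R y i + 1).
  rewrite bigA_distr; apply: eq_bigr => J _.
  by rewrite /chi -big_split big_mkcond.
have [->|xy] := eqVneq x y; last first.
  have [i xyi] : exists i, x i != y i.
    apply/existsP; apply: contra_neqT xy => /existsPn xy.
    by apply/ffunP => i; apply/eqP; have := xy i; rewrite negbK.
  rewrite mul0r (bigD1 i) //= [X in X * _](_ : _ = 0) ?mul0r //.
  by move: xyi; rewrite /coord; case: (x i); case: (y i) => //= _; ring.
rewrite mul1r card_ffun card_bool card_ord natrX -[in RHS](card_ord n).
rewrite -prodr_const.
by apply: eq_bigr => i _; rewrite -expr2 sqr_coord.
Qed.

Lemma fourier_inversion f x : \sum_J fourier f J * chi R J x = f x.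
Proof.
transitivity ((\sum_y f y * (\sum_J chi R J y * chi R J x)) / #|{: cube n}|%:R).
  under [in RHS]eq_bigr => y _ do rewrite mulr_sumr.
  rewrite exchange_big mulr_suml; apply: eq_bigr => J _.
  rewrite /fourier /expect mulrAC mulr_suml; congr (_ / _).
  by apply: eq_bigr => y _; rewrite mulrA.
rewrite (bigD1 x) //= [X in _ + X]big1 => [|y yx]; last first.
  by rewrite sum_chiM (negbTE yx) mul0r mulr0.
rewrite sum_chiM eqxx mul1r addr0 mulfK //.
by rewrite gt_eqF ?card_cube_gt0.
Qed.

Lemma parseval f : \sum_J fourier f J ^+ 2 = expect (fun x => f x ^+ 2).
Proof.
rewrite -expect_sqr_sum; apply: eq_expect => x.
by rewrite fourier_inversion.
Qed.

Lemma sum_set_split i (P : pred {set 'I_n}) (F : {set 'I_n} -> R) :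
  \sum_(J | P J) F J =
  \sum_(J | P J && (i \notin J)) F J +
  \sum_(J | P (i |: J) && (i \notin J)) F (i |: J).
Proof.
rewrite (bigID (fun J => i \notin J)) /=; congr (_ + _).
rewrite (reindex_onto (fun J => i |: J) (fun J => J :\ i)) => [|J /andP[_]].
  apply: eq_bigl => J; rewrite setU11 /= andbT; congr (_ && _).
  apply/eqP/idP => [<-|iJ]; first by rewrite setD11.
  by rewrite setU1K.
by rewrite negbK => /setD1K.
Qed.

(** Bonami's (2,4)-hypercontractive inequality, for sums of characters chi_J
    with I \subset J \subset A.  The common factor chi_I has square 1, so that
    only the elements of J outside I cost a factor 3. *)
Lemma bonami I A b : I \subset A ->
  expect (fun x => (\sum_(J : {set 'I_n} | (I \subset J) && (J \subset A))
                      b J * chi R J x) ^+ 4)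
  <= (\sum_(J : {set 'I_n} | (I \subset J) && (J \subset A))
        3 ^+ #|J :\: I| * b J ^+ 2) ^+ 2.
Proof.
move Ek : #|A :\: I| => k IA; elim: k A b IA Ek => [|k IHk] A b IA Ek.
  have -> : A = I.
    apply/eqP; rewrite eqEsubset IA andbT -setD_eq0; apply/eqP.
    exact: cards0_eq.
  have E (J : {set 'I_n}) : (I \subset J) && (J \subset I) = (J == I).
    by rewrite andbC -eqEsubset.
  under eq_expect => x do rewrite (eq_bigl _ _ E) big_pred1_eq.
  rewrite (eq_bigl _ _ E) big_pred1_eq setDv cards0 mul1r.
  rewrite -[leRHS](expect_cst n); apply: ler_expect => x.
  by rewrite -exprM (exprMn _ (b I) (chi R I x)) (exprM (chi R I x) 2 2) sqr_chi
     expr1n mulr1.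
have [i /setDP[iA iI]] : exists i, i \in A :\: I.
  by apply/card_gt0P; rewrite Ek.
(* The sum is G + x_i H, where G and H do not depend on x_i; terms of odd
   degree in x_i have mean zero. *)
set B := A :\ i.
have IB : I \subset B by rewrite subsetD1 IA iI.
have EB : #|B :\: I| = k.
  move: Ek; rewrite (cardsD1 i) inE iA iI add1n => -[<-].
  by rewrite /B !setDDl setUC.
have iB (J : {set 'I_n}) : (J \subset B) = (J \subset A) && (i \notin J).
  by rewrite subsetD1.
pose G x := \sum_(J : {set 'I_n} | (I \subset J) && (J \subset B))
    b J * chi R J x.
pose H x := \sum_(J : {set 'I_n} | (I \subset J) && (J \subset B))
    b (i |: J) * chi R J x.
have PU (J : {set 'I_n}) :
    (I \subset i |: J) && (i |: J \subset A) && (i \notin J) =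
    (I \subset J) && (J \subset B).
  rewrite iB subUset sub1set iA /= -andbA; congr (_ && _).
  have Ii : I :\ i = I by apply/setDidPl; rewrite disjoint_sym disjoints1.
  by rewrite -subDset Ii.
have iJ (J : {set 'I_n}) : (I \subset J) && (J \subset B) -> i \notin J.
  by rewrite iB => /and3P[].
have split_x x :
    \sum_(J : {set 'I_n} | (I \subset J) && (J \subset A)) b J * chi R J x =
    G x + coord R x i * H x.
  rewrite (sum_set_split i); congr (_ + _).
    by apply: eq_bigl => J; rewrite -andbA -iB.
  rewrite (eq_bigl _ _ PU) mulr_sumr; apply: eq_bigr => J /iJ iJ'.
  by rewrite chi_setU1 // mulrCA.
have Gf x : G (flip x i) = G x.
  by apply: eq_bigr => J /iJ iJ'; rewrite chi_flip_out.
have Hf x : H (flip x i) = H x.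
  by apply: eq_bigr => J /iJ iJ'; rewrite chi_flip_out.
set g := \sum_(J : {set 'I_n} | (I \subset J) && (J \subset B))
           3 ^+ #|J :\: I| * b J ^+ 2.
set h := \sum_(J : {set 'I_n} | (I \subset J) && (J \subset B))
           3 ^+ #|J :\: I| * b (i |: J) ^+ 2.
have hG : expect (fun x => G x ^+ 4) <= g ^+ 2 by exact: IHk.
have hH : expect (fun x => H x ^+ 4) <= h ^+ 2.
  exact: (IHk B (fun J => b (i |: J))).
have g0 : 0 <= g.
  by apply: sumr_ge0 => J _; rewrite mulr_ge0 ?sqr_ge0 // exprn_ge0.
have h0 : 0 <= h.
  by apply: sumr_ge0 => J _; rewrite mulr_ge0 ?sqr_ge0 // exprn_ge0.
have -> : \sum_(J : {set 'I_n} | (I \subset J) && (J \subset A))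
              3 ^+ #|J :\: I| * b J ^+ 2 = g + 3 * h.
  rewrite (sum_set_split i); congr (_ + _).
    by apply: eq_bigl => J; rewrite -andbA -iB.
  rewrite (eq_bigl _ _ PU) mulr_sumr; apply: eq_bigr => J /iJ iJ'.
  rewrite mulrA -exprS; congr (3 ^+ _ * _).
  by rewrite setDUl (setDidPl _) ?disjoints1 // cardsU1 inE (negbTE iJ') andbF.
have hGH : expect (fun x => G x ^+ 2 * H x ^+ 2) <= g * h.
  rewrite -ler_sqr ?nnegrE; last 2 first.
  - by apply: expect_ge0 => x; rewrite mulr_ge0 ?sqr_ge0.
  - exact: mulr_ge0.
  apply: le_trans (expect_CauchySchwarz _ _) _.
  rewrite exprMn; apply: ler_pM.
  - by apply: expect_ge0 => x; rewrite sqr_ge0.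
  - by apply: expect_ge0 => x; rewrite sqr_ge0.
  - by under eq_expect => x do rewrite -exprM.
  - by under eq_expect => x do rewrite -exprM.
have odd0 : expect (fun x =>
    coord R x i * (4 * (G x ^+ 3 * H x) + 4 * (G x * H x ^+ 3))) = 0.
  apply: (expect_odd (i := i)) => x.
  by rewrite Gf Hf coord_flip eqxx mulN1r mulNr.
have -> : expect (fun x =>
      (\sum_(J : {set 'I_n} | (I \subset J) && (J \subset A))
         b J * chi R J x) ^+ 4) =
    expect (fun x => G x ^+ 4) + 6 * expect (fun x => G x ^+ 2 * H x ^+ 2)
    + expect (fun x => H x ^+ 4).
  rewrite -[RHS]addr0 -[X in _ = _ + X]odd0 -expectZ -!expectD.
  apply: eq_expect => x; rewrite split_x.
  have c2 := sqr_coord x i.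
  have c3 : coord R x i ^+ 3 = coord R x i by rewrite exprS c2 mulr1.
  have c4 : coord R x i ^+ 4 = 1 by rewrite (exprM _ 2 2) c2 expr1n.
  rewrite (_ : (G x + _) ^+ 4 = G x ^+ 4
     + 4 * (coord R x i * (G x ^+ 3 * H x))
     + 6 * (coord R x i ^+ 2 * (G x ^+ 2 * H x ^+ 2))
     + 4 * (coord R x i ^+ 3 * (G x * H x ^+ 3)) + coord R x i ^+ 4 * H x ^+ 4);
    last by ring.
  by rewrite c2 c3 c4; ring.
by have := mulr_ge0 g0 h0; nra.
Qed.

End Characters.

(** * The part of the expansion above a set *)

Lemma setU1_ind (T : finType) (P : {set T} -> Prop) :
  P set0 -> (forall i (A : {set T}), i \notin A -> P A -> P (i |: A)) ->
  forall A, P A.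
Proof.
move=> P0 PU A; have [k] := ubnP #|A|; elim: k A => // k IHk A.
have [->//|[i iA]] := set_0Vmem A.
rewrite (cardsD1 i) iA add1n ltnS => cA; rewrite -(setD1K iA).
by apply: PU (IHk _ cA); rewrite setD11.
Qed.

Lemma sqr_exp2 (R : realType) k : (2 ^+ k) ^+ 2 = 4 ^+ k :> R.
Proof. by rewrite -exprM mulnC exprM; congr (_ ^+ k); ring. Qed.

Section Part.
Variables (R : realType) (n : nat).
Implicit Types (f : cube n -> R).
Implicit Types (x y : cube n) (i j : 'I_n) (I J A : {set 'I_n}).

(** T_I f: the part of the Fourier expansion of f carried by the supersets
    of I. *)
Definition Tpart I f x : R :=
  \sum_(J : {set 'I_n} | I \subset J) fourier f J * chi R J x.

Lemma Tpart0 f x : Tpart set0 f x = f x.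
Proof.
rewrite -[RHS]fourier_inversion; apply: eq_bigl => J; exact: sub0set.
Qed.

Lemma Tpart_setU1 i I f x : i \notin I ->
  Tpart (i |: I) f x = (Tpart I f x - Tpart I f (flip x i)) / 2.
Proof.
move=> iI; rewrite /Tpart -sumrB mulr_suml.
rewrite [RHS](bigID (fun J : {set 'I_n} => i \in J)) /=.
rewrite [X in _ = _ + X]big1 => [|J /andP[_ iJ]]; last first.
  by rewrite chi_flip_out // subrr mul0r.
rewrite addr0; apply: eq_big => [J|J]; first by rewrite subUset sub1set andbC.
by rewrite subUset sub1set => /andP[iJ _]; rewrite chi_flip_in //; field.
Qed.

Lemma expect_sqr_Tpart I f : expect (fun x => Tpart I f x ^+ 2) = Tinf I f.
Proof. exact: expect_sqr_sum. Qed.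

Lemma Tinf_ge0 I f : 0 <= Tinf I f.
Proof. by apply: sumr_ge0 => J _; exact: sqr_ge0. Qed.

Lemma sqr_Tpart_le1 I f x : (forall x, f x = 1 \/ f x = -1) ->
  Tpart I f x ^+ 2 <= 1.
Proof.
move=> f_sign; rewrite -real_normK ?num_real // expr_le1 ?normr_ge0 //.
elim/setU1_ind: I x => [x|i I iI IH x].
  by rewrite Tpart0; case: (f_sign x) => ->; rewrite ?normrN normr1.
rewrite Tpart_setU1 // normrM [X in _ * X]ger0_norm ?invr_ge0 //.
have := ler_normB (Tpart I f x) (Tpart I f (flip x i)).
by have := IH x; have := IH (flip x i); lra.
Qed.

(** Parity is what makes 2^(|I|-1), and not merely 2^|I|, clear the
    denominators of T_I f when I is non-empty. *)
Lemma Tpart_even I f x : (forall x, f x = 1 \/ f x = -1) -> I != set0 ->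
  exists z : int, 2 ^+ #|I| * Tpart I f x = 2 * z%:~R.
Proof.
move=> f_sign I_neq0.
(* The induction also covers I = set0, where T_I f = f is odd. *)
suff [z ->] : exists z : int,
    2 ^+ #|I| * Tpart I f x = (I == set0)%:R + 2 * z%:~R.
  by exists z; rewrite (negbTE I_neq0) add0r.
elim/setU1_ind: I x {I_neq0} => [x|i I iI IH x].
  rewrite cards0 mul1r Tpart0 eqxx.
  case: (f_sign x) => ->; [exists 0|exists (-1)].
    by rewrite mulr0 addr0.
  by rewrite mulrN1z /=; ring.
have [z Ez] := IH x; have [z' Ez'] := IH (flip x i).
exists (z - z'); rewrite (_ : (i |: I == set0) = false); last first.
  by apply/negP => /eqP/setP/(_ i); rewrite setU11 inE.
rewrite cardsU1 iI Tpart_setU1 // exprS intrB.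
transitivity (2 ^+ #|I| * Tpart I f x - 2 ^+ #|I| * Tpart I f (flip x i)).
  by field.
by rewrite Ez Ez' /=; ring.
Qed.

(** As 2^(|I|-1) T_I f is integer valued, its square is at least 1 where it
    does not vanish. *)
Lemma Tpart_gap I f x : (forall x, f x = 1 \/ f x = -1) -> I != set0 ->
  (Tpart I f x != 0)%:R <= 4 ^+ #|I|.-1 * Tpart I f x ^+ 2.
Proof.
move=> f_sign I_neq0; have [z Ez] := Tpart_even x f_sign I_neq0.
have [->|T_neq0] := eqVneq; first by rewrite expr0n mulr0.
have {}Ez : 2 ^+ #|I|.-1 * Tpart I f x = z%:~R.
  have two_neq0 : 2 != 0 :> R by rewrite pnatr_eq0.
  apply: (mulfI two_neq0).
  by rewrite mulrA -exprS prednK // card_gt0.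
have -> : 4 ^+ #|I|.-1 * Tpart I f x ^+ 2 = (2 ^+ #|I|.-1 * Tpart I f x) ^+ 2.
  by rewrite [RHS]exprMn sqr_exp2.
rewrite Ez -rmorphXn /=.
rewrite -[leLHS]/(1%:~R) ler_int -gtz0_ge1 lt_def sqr_ge0 andbT expf_eq0 /=.
apply: contra_neq T_neq0 => z0.
move/eqP: Ez; rewrite z0 mulf_eq0 expf_eq0 /= pnatr_eq0 /= andbF /=.
by move/eqP.
Qed.

Lemma Tpart_flip I f x i : i \notin I ->
  (forall y, (forall j, j \notin I -> y j = x j) -> f y = f (flip y i)) ->
  Tpart I f x = Tpart I f (flip x i).
Proof.
elim/setU1_ind: I x => [x _ fi|j I jI IH x].
  by rewrite !Tpart0; apply: fi.
rewrite !inE negb_or => /andP[ij iI] fi.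
rewrite !Tpart_setU1 // flipC -!IH //= => y yx; apply: fi => k;
  rewrite in_setU1 negb_or => /andP[kj kI]; rewrite yx //.
by rewrite ffunE (negbTE kj).
Qed.

Lemma Tpart_pivotal I f x i : i \in I -> Tpart I f x != 0 -> pivotal I f x i.
Proof.
move=> iI; apply: contra_neqT => /existsPn nopiv.
rewrite -(setD1K iI) Tpart_setU1 ?setD11 //.
rewrite -Tpart_flip ?setD11 ?subrr ?mul0r // => y yx.
have := nopiv y; rewrite negb_and negbK => /orP[/forall_inPn[j]|/eqP//].
by rewrite inE => jI; rewrite yx ?eqxx // inE negb_and jI orbT.
Qed.

Lemma Tinf_le_JInf I f : (forall x, f x = 1 \/ f x = -1) ->
  Tinf I f <= JInf I f.
Proof.
move=> f_sign; rewrite -expect_sqr_Tpart /JInf prob_expect.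
apply: ler_expect => x.
have [->|T_neq0] := eqVneq (Tpart I f x) 0; first by rewrite expr0n ler0n.
have -> : [forall i in I, pivotal I f x i].
  by apply/forall_inP => i iI; exact: Tpart_pivotal.
exact: sqr_Tpart_le1.
Qed.

(** * Hypercontractive bound on a single influence *)

(** The influence Inf_I after attenuation: the Fourier weight of J is damped by
    1/3 for each element of J outside I. *)
Definition Tinf_noisy I f : R :=
  \sum_(J : {set 'I_n} | I \subset J) 3^-1 ^+ #|J :\: I| * fourier f J ^+ 2.

Lemma Tinf_noisy_ge0 I f : 0 <= Tinf_noisy I f.
Proof.
by apply: sumr_ge0 => J _; rewrite mulr_ge0 ?sqr_ge0 // exprn_ge0 ?invr_ge0.
Qed.

(** The bound Tinf_noisy I f <= 2^(|I|-1) Inf_I(f)^(3/2), squared.  With h the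
    damped T_I f and s the indicator of T_I f != 0, the left-hand side is the
    square of E[T_I f * (s * h)]; apply Cauchy-Schwarz twice, and Bonami's
    inequality to E[h^4]. *)
Lemma sqr_Tinf_noisy_le I f : (forall x, f x = 1 \/ f x = -1) -> I != set0 ->
  Tinf_noisy I f ^+ 2 <= 4 ^+ #|I|.-1 * Tinf I f ^+ 3.
Proof.
move=> f_sign I_neq0.
pose h x := \sum_(J : {set 'I_n} | I \subset J)
  (3^-1 ^+ #|J :\: I| * fourier f J) * chi R J x.
pose s x : R := (Tpart I f x != 0)%:R.
have s2 x : s x ^+ 2 = s x by rewrite /s; case: eqP; rewrite ?expr0n ?expr1n.
set H := Tinf_noisy I f.
have EH : H = expect (fun x => Tpart I f x * (s x * h x)).
  transitivity (expect (fun x => Tpart I f x * h x)).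
    (* Polarization reduces the mixed product to sums of squares. *)
    have polar x : Tpart I f x * h x =
        4^-1 * (Tpart I f x + h x) ^+ 2 + (- 4^-1) * (Tpart I f x - h x) ^+ 2.
      by field.
    rewrite (eq_expect polar) expectD !expectZ.
    under eq_expect => x.
      rewrite /Tpart /h -big_split /=; under eq_bigr do rewrite -mulrDl; over.
    under [X in _ = _ + _ * X]eq_expect => x.
      rewrite /Tpart /h -sumrB /=; under eq_bigr do rewrite -mulrBl; over.
    rewrite !expect_sqr_sum !mulr_sumr -big_split; apply: eq_bigr => J _ /=.
    by field.
  apply: eq_expect => x; rewrite mulrA; congr (_ * _); rewrite /s.
  by case: eqP => [->|_]; rewrite ?mulr0 ?mulr1.
have h4 : expect (fun x => h x ^+ 4) <= H ^+ 2.
  have sT (J : {set 'I_n}) : (I \subset J) && (J \subset setT) = (I \subset J).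
    by rewrite subsetT andbT.
  have := bonami (fun J => 3^-1 ^+ #|J :\: I| * fourier f J) (subsetT I).
  under eq_expect do rewrite (eq_bigl _ _ sT).
  rewrite (eq_bigl _ _ sT) => /le_trans; apply.
  rewrite le_eqVlt; apply/orP; left; apply/eqP; congr (_ ^+ 2).
  apply: eq_bigr => J _.
  have p1 : 3 ^+ #|J :\: I| * 3^-1 ^+ #|J :\: I| = 1 :> R.
    by rewrite -exprMn mulfV ?expr1n // pnatr_eq0.
  move: (3 ^+ _) (3^-1 ^+ _) p1 => c a p1.
  by transitivity (c * a * (a * fourier f J ^+ 2)); [ring | rewrite p1 mul1r].
have H0 : 0 <= H by exact: Tinf_noisy_ge0.
pose K := expect (fun x => s x * h x ^+ 2).
have H2 : H ^+ 2 <= Tinf I f * K.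
  rewrite [in leLHS]EH; apply: le_trans (expect_CauchySchwarz _ _) _.
  rewrite expect_sqr_Tpart.
  under [X in _ * X <= _]eq_expect do rewrite exprMn s2.
  exact: lexx.
have K2 : K ^+ 2 <= (4 ^+ #|I|.-1 * Tinf I f) * H ^+ 2.
  apply: le_trans (expect_CauchySchwarz _ _) _.
  apply: ler_pM.
  - by apply: expect_ge0 => x; rewrite sqr_ge0.
  - by apply: expect_ge0 => x; rewrite sqr_ge0.
  - rewrite -expect_sqr_Tpart -expectZ; apply: ler_expect => x.
    by rewrite s2; exact: Tpart_gap.
  - by under eq_expect do rewrite -exprM.
have T0 := Tinf_ge0 I f.
have [->|H_neq0] := eqVneq H 0.
  by rewrite expr0n /= mulr_ge0 // exprn_ge0.
have H2_gt0 : 0 < H ^+ 2 by rewrite exprn_gt0 // lt_def H_neq0.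
rewrite -(ler_pM2r H2_gt0).
have := ler_pM (ltW H2_gt0) (ltW H2_gt0) H2 H2.
have := ler_wpM2l (sqr_ge0 (Tinf I f)) K2.
by nra.
Qed.

End Part.

(** * Counting, power means and Jensen's inequality *)

(** Each J has C(|J|, d) subsets of size d. *)
Lemma sum_card_subset (R : realType) (T : finType) (d : nat)
    (a : {set T} -> R) :
  \sum_(I : {set T} | #|I| == d) \sum_(J : {set T} | I \subset J) a J =
  \sum_(J : {set T}) 'C(#|J|, d)%:R * a J.
Proof.
rewrite (exchange_big_dep predT) //=; apply: eq_bigr => J _.
rewrite -cards_draws mulr_natl -sumr_const; apply: eq_bigl => I.
by rewrite inE andbC.
Qed.

Lemma ler_sum_card_subset (R : realType) (T : finType) (d : nat)
    (a : {set T} -> R) (c : nat -> R) : (forall J, 0 <= a J) ->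
    (forall k, c k <= 'C(k + d, d)%:R) ->
  \sum_(J : {set T} | (d <= #|J|)%N) a J * c (#|J| - d)%N <=
  \sum_(I : {set T} | #|I| == d) \sum_(J : {set T} | I \subset J) a J.
Proof.
move=> a0 cC; rewrite sum_card_subset.
rewrite [leRHS](bigID (fun J : {set T} => d <= #|J|)%N) /=.
rewrite -[leLHS]addr0; apply: lerD.
  by apply: ler_sum => J dJ; rewrite mulrC ler_wpM2r // -{2}(subnK dJ).
by apply: sumr_ge0 => J _; rewrite mulr_ge0.
Qed.

Lemma leq_exp_ffact k d : (k.+1 ^ d <= (k + d) ^_ d)%N.
Proof.
elim: d => // d IHd.
by rewrite addnS ffactnS /= expnS leq_mul // ltnS leq_addr.
Qed.

Lemma leq_ffact_exp n d : (n ^_ d <= n ^ d)%N.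
Proof.
by elim: d => // d IHd; rewrite ffactnSr expnSr leq_mul // leq_subr.
Qed.

(** The weights w are not normalized: W is their total mass, and a mean of y
    at most mu is written as \sum w y <= W mu. *)
Section Means.
Variables (R : realType) (T : finType) (P : pred T) (w y : T -> R).
Hypothesis w_ge0 : forall t, 0 <= w t.
Hypothesis y_ge0 : forall t, 0 <= y t.
Let W := \sum_(t | P t) w t.

(** The graph of z |-> z^(d+1) lies above its tangent at mu. *)
Lemma exp_tangent (z mu : R) d : 0 <= z -> 0 < mu ->
  mu ^+ d.+1 + d.+1%:R * mu ^+ d * (z - mu) <= z ^+ d.+1.
Proof.
move=> z0 mu0; elim: d => [|d IHd]; first by rewrite expr0 !expr1; lra.
have mud : 0 <= mu ^+ d by rewrite exprn_ge0 // ltW.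
have := ler_wpM2l z0 IHd; rewrite -exprS; apply: le_trans.
rewrite -subr_ge0 (_ : _ - _ = d.+1%:R * mu ^+ d * (z - mu) ^+ 2).
  by rewrite mulr_ge0 ?sqr_ge0 // mulr_ge0.
by rewrite [d.+2%:R]mulrS !exprS; ring.
Qed.

Lemma power_mean mu d : 0 < mu ->
  \sum_(t | P t) w t * y t ^+ d.+1 <= W * mu ^+ d.+1 ->
  \sum_(t | P t) w t * y t <= W * mu.
Proof.
move=> mu0 hd.
have : \sum_(t | P t) w t * (mu ^+ d.+1 + d.+1%:R * mu ^+ d * (y t - mu))
       <= W * mu ^+ d.+1.
  apply: le_trans hd; apply: ler_sum => t _.
  by rewrite ler_wpM2l // exp_tangent.
have -> : \sum_(t | P t) w t * (mu ^+ d.+1 + d.+1%:R * mu ^+ d * (y t - mu)) =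
    W * mu ^+ d.+1 +
    (d.+1%:R * mu ^+ d) * (\sum_(t | P t) w t * y t - W * mu).
  rewrite /W !mulr_suml -sumrB mulr_sumr -big_split; apply: eq_bigr => t _ /=.
  by ring.
rewrite gerDl pmulr_rle0 ?subr_le0 //.
by rewrite mulr_gt0 ?exprn_gt0 // ltr0n.
Qed.

Lemma jensen_expR a mu : 0 <= a -> \sum_(t | P t) w t * y t <= W * mu ->
  W * expR (- (a * mu)) <= \sum_(t | P t) w t * expR (- (a * y t)).
Proof.
move=> a0 hy.
have -> : \sum_(t | P t) w t * expR (- (a * y t)) =
  expR (- (a * mu)) * \sum_(t | P t) w t * expR (a * (mu - y t)).
  rewrite mulr_sumr; apply: eq_bigr => t _.
  by rewrite mulrCA -expRD; congr (_ * expR _); ring.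
rewrite mulrC ler_wpM2l ?expR_ge0 //.
apply: (@le_trans _ _ (\sum_(t | P t) w t * (1 + a * (mu - y t)))); last first.
  by apply: ler_sum => t _; rewrite ler_wpM2l // expR_ge1Dx.
have -> : \sum_(t | P t) w t * (1 + a * (mu - y t)) =
    W + a * (W * mu - \sum_(t | P t) w t * y t).
  rewrite /W mulr_suml -sumrB mulr_sumr -big_split; apply: eq_bigr => t _ /=.
  by ring.
by rewrite lerDl mulr_ge0 // subr_ge0.
Qed.

End Means.

(** * Numerical estimates *)

Section Numerics.
Variable R : realType.

Lemma expR_6_5_ge3 : 3 <= expR (6 / 5) :> R.
Proof.
have -> : 6 / 5 = 8%:R * (3 / 20) :> R by field.
rewrite expRM_natl.
apply: (@le_trans _ _ ((23 / 20) ^+ 8)); first by lra.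
apply: lerXn2r; rewrite ?nnegrE ?expR_ge0 //; first by lra.
by apply: le_trans (expR_ge1Dx _); lra.
Qed.

Lemma expR_ge_half_cube (L : R) : 0 <= L -> L ^+ 3 / 8 <= expR (3 / 5 * L).
Proof.
move=> L0.
have e_ge : 5 / 2 <= expR 1 :> R.
  have -> : 1 = 8%:R * 8^-1 :> R by field.
  rewrite expRM_natl; apply: (@le_trans _ _ ((9 / 8) ^+ 8)); first by lra.
  apply: lerXn2r; rewrite ?nnegrE ?expR_ge0 //; first by lra.
  by apply: le_trans (expR_ge1Dx _); lra.
have -> : 3 / 5 * L = 3%:R * (L / 5) by field.
have -> : L ^+ 3 / 8 = (L / 2) ^+ 3 by field.
rewrite expRM_natl; apply: lerXn2r; rewrite ?nnegrE ?expR_ge0 //; first by lra.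
(* e^y >= e y with y = L / 5, and e >= 5 / 2. *)
have -> : L / 5 = 1 + (L / 5 - 1) by ring.
rewrite expRD; have := expR_ge1Dx (L / 5 - 1); rewrite addrC subrK => h.
have := ler_wpM2r (_ : 0 <= L / 5) e_ge; have := ler_wpM2l (expR_ge0 1) h.
by move=> h1 h2; apply: le_trans h1; apply: le_trans (h2 _); lra.
Qed.

(* Numerals are unary natural numbers, whence 36 * 10 ^+ 3 for 36000. *)
Lemma exp32_lt_sqr_fact d : (0 < d)%N ->
  32 ^+ d < 36 * 10 ^+ 3 * d`!%:R ^+ 2 :> R.
Proof.
have step k : (5 <= k)%N -> 32 ^+ k < 36 * 10 ^+ 3 * k`!%:R ^+ 2 :> R ->
    32 ^+ k.+1 < 36 * 10 ^+ 3 * k.+1`!%:R ^+ 2 :> R.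
  move=> k5 IHk; rewrite exprS factS natrM exprMn [ltRHS]mulrCA.
  apply: ltr_pM; rewrite ?exprn_ge0 //.
  have : 6 <= k.+1%:R :> R by rewrite ler_nat.
  by rewrite expr2; nra.
elim: d => // d IHd _; have [d5|] := leqP 5 d.
  by apply: step (IHd _) => //; apply: leq_trans d5.
case: d {IHd} => [|[|[|[|[|d]]]]] // _.
- by rewrite (_ : 1`! = 1)%N //; lra.
- by rewrite (_ : 2`! = 2)%N //; lra.
- by rewrite (_ : 3`! = 6)%N //; lra.
- by rewrite (_ : 4`! = 24)%N //; lra.
- by rewrite (_ : 5`! = 120)%N //; lra.
Qed.

(** The minimum of (x/6)^x over x > 0 is e^(-6/e) > 1/10. *)
Lemma exp_sixth_ge d : (0 < d)%N -> 10^-1 <= (d%:R / 6) ^+ d :> R.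
Proof.
move=> d0; have [d6|] := leqP 6 d.
  have : 1 <= (d%:R / 6) ^+ d :> R.
    by apply: exprn_ege1; rewrite ler_pdivlMr // mul1r ler_nat.
  by lra.
by case: d d0 => [|[|[|[|[|[|]]]]]] // _ _; lra.
Qed.

(** In the argument L = ln n, and q = 2^(d-1) t^(1/2) is the factor gained by
    hypercontractivity from the assumption that all influences are below t. *)
Lemma no_small_influence (L q : R) d : (0 < d)%N -> 0 < L -> 0 <= q ->
  q ^+ 2 <= 4 ^+ d.-1 * (10^-1 * (L / expR L) ^+ d) ->
  q * (10^-1 * L ^+ d) < expR (- (6 / 5 * (d%:R / 6 * L - 1))) * d`!%:R.
Proof.
move=> d0 L0 q0 q2.
have F0 : 0 < d`!%:R :> R by rewrite ltr0n fact_gt0.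
have Ld : 0 < L ^+ d by rewrite exprn_gt0.
rewrite -ltr_sqr ?nnegrE ?mulr_ge0 ?expR_ge0 ?invr_ge0 ?(ltW Ld) ?(ltW F0) //.
set E := expR L.
have E0 : 0 < E ^+ d by rewrite exprn_gt0 // expR_gt0.
have -> : (expR (- (6 / 5 * (d%:R / 6 * L - 1))) * d`!%:R) ^+ 2 =
    expR (6 / 5) ^+ 2 * d`!%:R ^+ 2 * expR (3 / 5 * L) ^+ d / E ^+ d.
  rewrite exprMn [in LHS](_ : expR _ ^+ 2 =
    expR (6 / 5) ^+ 2 * expR (3 / 5 * L) ^+ d / E ^+ d).
    by ring.
  by rewrite /E -!expRM_natl -expRN -!expRD; congr expR; field.
rewrite ltr_pdivlMr //.
have h1 : (q * (10^-1 * L ^+ d)) ^+ 2 * E ^+ d <=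
    (4 * 10 ^+ 3)^-1 * 32 ^+ d * ((L ^+ 3) / 8) ^+ d.
  have -> : (q * (10^-1 * L ^+ d)) ^+ 2 * E ^+ d =
     q ^+ 2 * (100^-1 * (L ^+ d) ^+ 2 * E ^+ d) by field.
  apply: le_trans (ler_wpM2r _ q2) _.
    by rewrite mulr_ge0 ?(ltW E0) // mulr_ge0 ?sqr_ge0 // invr_ge0.
  have -> : 32 ^+ d = 8 ^+ d * (4 * 4 ^+ d.-1) :> R.
    rewrite -exprS prednK // -exprMn; congr (_ ^+ _); by ring.
  have -> : (L ^+ 3 / 8) ^+ d = (L ^+ d) ^+ 3 / 8 ^+ d.
    by rewrite expr_div_n -!exprM mulnC.
  rewrite expr_div_n le_eqVlt; apply/orP; left; apply/eqP; field.
  by rewrite !expf_neq0 ?pnatr_eq0 // gt_eqF ?expR_gt0.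
apply: le_lt_trans h1 _.
have V0 : 0 < (L ^+ 3 / 8) ^+ d by rewrite exprn_gt0 // divr_gt0 // exprn_gt0.
have h2 : (L ^+ 3 / 8) ^+ d <= expR (3 / 5 * L) ^+ d.
  rewrite lerXn2r ?nnegrE ?expR_ge0 ?divr_ge0 ?exprn_ge0 ?(ltW L0) //.
  by rewrite expR_ge_half_cube // ltW.
have h3 : 9 <= expR (6 / 5) ^+ 2 :> R.
  by have := expR_6_5_ge3; nra.
have h4 := exp32_lt_sqr_fact d0.
apply: (@lt_le_trans _ _ (9 * d`!%:R ^+ 2 * (L ^+ 3 / 8) ^+ d)).
  by rewrite ltr_pM2r //; lra.
apply: ler_pM => //; [by rewrite mulr_ge0 ?sqr_ge0|exact: ltW|].
by rewrite ler_pM2r // exprn_gt0.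
Qed.

End Numerics.

(** * Existence of a large influence *)

Section LargeInfluence.
Variables (R : realType) (n d : nat) (f : cube n -> R).
Hypothesis d_gt0 : (0 < d)%N.
Hypothesis f_sign : forall x, f x = 1 \/ f x = -1.
Implicit Types I J : {set 'I_n}.

Lemma weight_ge_le1 : weight_ge d f <= 1.
Proof.
have <- : \sum_J fourier f J ^+ 2 = 1.
  rewrite parseval -[RHS](expect_cst n); apply: eq_expect => x.
  by case: (f_sign x) => ->; rewrite ?sqrrN expr1n.
rewrite [leRHS](bigID (fun J => d <= #|J|)%N) /= lerDl.
by apply: sumr_ge0 => J _; exact: sqr_ge0.
Qed.

Lemma sum_Tinf_le (t : R) : (forall I, #|I| = d -> Tinf I f <= t) -> 0 <= t ->
  (\sum_(I : {set 'I_n} | #|I| == d) Tinf I f) * d`!%:R <= n%:R ^+ d * t.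
Proof.
move=> Tt t0.
apply: (@le_trans _ _ (('C(n, d)%:R * t) * d`!%:R)).
  rewrite ler_wpM2r //.
  have -> : 'C(n, d) = #|[pred I : {set 'I_n} | #|I| == d]|.
    have -> : 'C(n, d) = 'C(#|[set: 'I_n]|, d) by rewrite cardsT card_ord.
    by rewrite -cards_draws; apply: eq_card => I; rewrite !inE subsetT.
  rewrite mulr_natl -sumr_const; apply: ler_sum => I /eqP; exact: Tt.
rewrite mulrAC -natrM bin_ffact ler_wpM2r // -natrX ler_nat.
exact: leq_ffact_exp.
Qed.

(** If the influences of sets of size d are small on average, then, weighted by
    f^(J)^2 over |J| >= d, the mean of |J| - d + 1 is at most d L / 6. *)
Lemma weighted_mean_level (L : R) : 0 < L ->
  (\sum_(I : {set 'I_n} | #|I| == d) Tinf I f) * d`!%:R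
    <= 10^-1 * weight_ge d f * L ^+ d ->
  \sum_(J : {set 'I_n} | (d <= #|J|)%N)
     fourier f J ^+ 2 * (#|J| - d).+1%:R <= weight_ge d f * (d%:R / 6 * L).
Proof.
move=> L0 hB; have mu0 : 0 < d%:R / 6 * L.
  by rewrite mulr_gt0 // divr_gt0 // ltr0n.
apply: (@power_mean _ _ (fun J => d <= #|J|)%N (fun J => fourier f J ^+ 2)
  (fun J => (#|J| - d).+1%:R) _ _ _ d.-1) => // [J|]; first exact: sqr_ge0.
rewrite prednK //.
apply: le_trans (_ : 10^-1 * weight_ge d f * L ^+ d <= _); last first.
  rewrite exprMn mulrA [10^-1 * _]mulrC ler_wpM2r ?exprn_ge0 ?(ltW L0) //.
  rewrite ler_wpM2l ?exp_sixth_ge //.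
  by apply: sumr_ge0 => J _; exact: sqr_ge0.
apply: le_trans hB; rewrite -ler_pdivrMr ?ltr0n ?fact_gt0 // mulr_suml.
under eq_bigr do rewrite -mulrA.
apply: (ler_sum_card_subset (c := fun k => k.+1%:R ^+ d / d`!%:R)) => [J|k].
  exact: sqr_ge0.
rewrite ler_pdivrMr ?ltr0n ?fact_gt0 // -natrX -natrM ler_nat bin_ffact.
exact: leq_exp_ffact.
Qed.

(** Bound each binomial coefficient below by 1 and 3^-m by e^(-6/5 m), then
    apply Jensen's inequality with m = |J| - d. *)
Lemma sum_Tinf_noisy_ge (mu : R) :
  \sum_(J : {set 'I_n} | (d <= #|J|)%N)
     fourier f J ^+ 2 * (#|J| - d).+1%:R <= weight_ge d f * mu ->
  weight_ge d f * expR (- (6 / 5 * (mu - 1)))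
    <= \sum_(I : {set 'I_n} | #|I| == d) Tinf_noisy I f.
Proof.
move=> hmu.
have -> : \sum_(I : {set 'I_n} | #|I| == d) Tinf_noisy I f =
    \sum_(I : {set 'I_n} | #|I| == d) \sum_(J : {set 'I_n} | I \subset J)
       3^-1 ^+ (#|J| - d) * fourier f J ^+ 2.
  by apply: eq_bigr => I /eqP dI; apply: eq_bigr => J IJ; rewrite cardsDS ?dI.
have a0 J : 0 <= 3^-1 ^+ (#|J| - d) * fourier f J ^+ 2.
  by rewrite mulr_ge0 ?sqr_ge0 // exprn_ge0 // invr_ge0.
have bin1 k : 1 <= 'C(k + d, d)%:R :> R by rewrite ler1n bin_gt0 leq_addl.
apply: le_trans (ler_sum_card_subset (c := fun=> 1) a0 bin1).
have w0 J : 0 <= fourier f J ^+ 2 by exact: sqr_ge0.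
have a_ge0 : 0 <= 6 / 5 :> R by lra.
have -> : weight_ge d f * expR (- (6 / 5 * (mu - 1))) =
    weight_ge d f * expR (- (6 / 5 * mu)) * expR (6 / 5).
  by rewrite -[RHS]mulrA -expRD; congr (_ * expR _); ring.
apply: le_trans (ler_wpM2r (expR_ge0 _) (jensen_expR w0 a_ge0 hmu)) _.
rewrite mulr_suml; apply: ler_sum => J _.
rewrite mulr1 -mulrA -expRD mulrC ler_wpM2r //.
rewrite (_ : _ + _ = - ((#|J| - d)%:R * (6 / 5))); last by rewrite mulrS; ring.
rewrite expRN expRM_natl -exprVn lerXn2r ?nnegrE ?invr_ge0 ?expR_ge0 //.
by rewrite lef_pV2 ?posrE ?expR_gt0 ?expR_6_5_ge3.
Qed.

Lemma Tinf_noisy_le (t : R) I : #|I| = d -> Tinf I f <= t ->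
  Tinf_noisy I f <= 2 ^+ d.-1 * Num.sqrt t * Tinf I f.
Proof.
move=> dI Tt; have T0 := Tinf_ge0 I f; have t0 := le_trans T0 Tt.
rewrite -ler_sqr ?nnegrE ?Tinf_noisy_ge0 ?mulr_ge0 ?exprn_ge0 ?sqrtr_ge0 //.
have I_neq0 : I != set0 by rewrite -card_gt0 dI.
apply: le_trans (sqr_Tinf_noisy_le f_sign I_neq0) _.
rewrite dI 2!exprMn sqr_sqrtr // sqr_exp2 -mulrA.
by rewrite ler_wpM2l ?exprn_ge0 // exprS ler_wpM2r ?exprn_ge0.
Qed.

Lemma exists_large_Tinf : (d <= n)%N -> exists2 I : {set 'I_n}, #|I| = d &
  10^-1 * weight_ge d f * (ln n%:R / n%:R) ^+ d <= Tinf I f.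
Proof.
move=> d_le_n; set W := weight_ge d f; set L := ln _.
have W0 : 0 <= W by apply: sumr_ge0 => J _; exact: sqr_ge0.
set t := 10^-1 * W * _.
have [I0 dI0] : exists I : {set 'I_n}, #|I| = d.
  have : (0 < #|[set I : {set 'I_n} | I \subset setT & #|I| == d]|)%N.
    by rewrite cards_draws cardsT card_ord bin_gt0.
  by case/card_gt0P => I; rewrite inE => /andP[_ /eqP]; exists I.
have [/existsP[I /andP[/eqP dI tI]]|noI] :=
  boolP [exists I : {set 'I_n}, (#|I| == d) && (t <= Tinf I f)].
  by exists I.
have small (I : {set 'I_n}) : #|I| = d -> Tinf I f < t.
  move=> dI; move/existsPn: noI => /(_ I).
  by rewrite dI eqxx /= -ltNge.
have t0 : 0 < t by apply: le_lt_trans (small _ dI0); exact: Tinf_ge0.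
exfalso.
have n0 : (0 < n)%N by apply: leq_trans d_le_n.
have [n1|n2] := leqP n 1.
  (* Here ln n = 0, so t = 0. *)
  have n_eq1 : n = 1%N by apply/eqP; rewrite eqn_leq n1.
  move: t0; rewrite /t /L [n in ln n%:R]n_eq1 ln1 mul0r expr0n gtn_eqF //.
  by rewrite mulr0 ltxx.
have nR : 0 < n%:R :> R by rewrite ltr0n.
have L0 : 0 < L by rewrite ln_gt0 // ltr1n.
have EL : expR L = n%:R by rewrite lnK // posrE.
have W_gt0 : 0 < W.
  rewrite lt_def W0 andbT; apply: contraTneq t0 => W_eq0.
  by rewrite /t W_eq0 mulr0 mul0r ltxx.
set B := \sum_(I : {set 'I_n} | #|I| == d) Tinf I f.
have hB : B * d`!%:R <= 10^-1 * W * L ^+ d.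
  apply: le_trans (sum_Tinf_le _ (ltW t0)) _ => [I /small/ltW//|].
  rewrite mulrCA -exprMn mulrCA mulfV ?mulr1 //.
  by rewrite gt_eqF.
set q := 2 ^+ d.-1 * Num.sqrt t.
have q0 : 0 <= q by rewrite mulr_ge0 ?exprn_ge0 ?sqrtr_ge0.
have hN : W * expR (- (6 / 5 * (d%:R / 6 * L - 1))) <= q * B.
  apply: le_trans (sum_Tinf_noisy_ge (weighted_mean_level L0 hB)) _.
  rewrite mulr_sumr; apply: ler_sum => I /eqP dI.
  exact/Tinf_noisy_le/ltW/small.
have q2 : q ^+ 2 <= 4 ^+ d.-1 * (10^-1 * (L / expR L) ^+ d).
  rewrite exprMn (sqr_sqrtr (ltW t0)) sqr_exp2.
  rewrite ler_wpM2l ?exprn_ge0 // EL /t -mulrA ler_wpM2l ?invr_ge0 //.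
  rewrite ler_piMl ?weight_ge_le1 // exprn_ge0 //.
  by rewrite divr_ge0 ?(ltW L0) ?(ltW nR).
have := no_small_influence d_gt0 L0 q0 q2; rewrite ltNge => /negP; apply.
rewrite -(ler_pM2l W_gt0) mulrA.
have F0 : 0 <= d`!%:R :> R by rewrite ler0n.
apply: le_trans (ler_wpM2r F0 hN) _.
rewrite -mulrA; apply: le_trans (ler_wpM2l q0 hB) _.
by rewrite le_eqVlt; apply/orP; left; apply/eqP; ring.
Qed.

End LargeInfluence.

Theorem theorem1p5 (R : realType) (n d : nat) (d_ge1 : (1 <= d)%N)
    (d_le_n : (d <= n)%N) (f : cube n -> R)
    (f_sign : forall x : cube n, f x = 1 \/ f x = -1) :
  exists I : {set 'I_n},
    [/\ #|I| = d,
        Tinf I f <= JInf I f &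
        10^-1 * weight_ge d f * (ln n%:R / n%:R) ^+ d <= Tinf I f].
Proof.
have [I dI tI] := exists_large_Tinf d_ge1 f_sign d_le_n.
by exists I; split=> //; exact: Tinf_le_JInf.
Qed.
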